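(* Let $P\in\mathcal{P}_2(\mathbb{R})$, let $[t_0,t_1]\subset[0,1]$ with $t_0<t_1$, let $z_0,z_1\in\mathbb{R}$ and let $p\ge1$ be an integer. Consider the problem $$\text{(A)}\qquad S=\underset{L\in\mathbb{R}[x]_{\le p}}{\operatorname{argmin}}\ \int_{t_0}^{t_1}\bigl(F_P^{\leftarrow}(x)-L(x)\bigr)^2dx\quad\text{s.t. } L(t_0)=z_0,\ L(t_1)=z_1,\ L'(x)\ge0\ \ \forall x\in[t_0,t_1].$$ Let $M$ be the $(p+1)\times(p+1)$ moment matrix of the Lebesgue measure on $[t_0,t_1]$, i.e. for $i,j=1,\dots,p+1$, $$M_{ij}=\int_{t_0}^{t_1}x^{i+j-2}dx=\frac{t_1^{i+j-1}-t_0^{i+j-1}}{i+j-1},$$ and let $r=(r_0,\dots,r_p)^\top\in\mathbb{R}^{p+1}$ be given by $r_i=\int_{t_0}^{t_1}x^iF_P^{\rightarrow}(x)\,dx$. Let $$\mathcal{K}=\Bigl\{s=(s_0,\dots,s_p)^\top\in\mathbb{R}^{p+1}\ \Bigm|\ L_s(x)=\sum_{i=0}^p s_ix^i \text{ satisfies } L_s(t_0)=z_0,\ L_s(t_1)=z_1,\ L_s'(x)\ge0\ \forall x\in[t_0,t_1]\Bigr\}.$$ Then $M$ is symmetric positive definite, $\mathcal{K}$ is a closed convex subset of $\mathbb{R}^{p+1}$, and a polynomial $S(x)=\sum_{i=0}^p s_i^*x^i$ is the solution of (A) if and only if its coefficient vector $s^*=(s_0^*,\dots,s_p^* )^\top$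 is the solution of the convex constrained quadratic program $$s^*=\underset{s\in\mathbb{R}^{p+1}}{\operatorname{argmin}}\ s^\top Ms-2s^\top r\quad\text{s.t. } s\in\mathcal{K}.$$
   Context: $\mathcal{P}_2(\mathbb{R})$ is the set of Borel probability measures on $\mathbb{R}$ with finite second moment. For $P\in\mathcal{P}_2(\mathbb{R})$ with cdf $F_P(t)=P((-\infty,t])$ and $a\in(0,1)$, $F_P^{\leftarrow}(a)=\inf\{t\in\mathbb{R}\mid F_P(t)\ge a\}$ and $F_P^{\rightarrow}(a)=\inf\{t\in\mathbb{R}\mid F_P(t)>a\}$ are the left- and right-continuous generalized inverses of $F_P$ (square integrable on $(0,1)$). $\mathbb{R}[x]_{\le p}$ is the set of real polynomials of degree at most $p$. *)

(* Defs.v *)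
From HB Require Import structures.
From mathcomp Require Import all_boot all_order all_algebra.
From mathcomp Require Import all_classical all_reals all_analysis.

Set Implicit Arguments.
Unset Strict Implicit.
Unset Printing Implicit Defensive.

Import Order.TTheory GRing.Theory Num.Theory.
Import numFieldNormedType.Exports.

Local Open Scope classical_set_scope.
Local Open Scope ring_scope.

Definition finite_second_moment (R : realType)
    (P : probability (measurableTypeR R) R) : Prop :=
  (\int[P]_x (x ^+ 2)%:E < +oo)%E.

Definition cdf_of (R : realType) (P : probability (measurableTypeR R) R)
    (t : R) : R := fine (P `]-oo, t]%classic).

(** The sets below are nonempty and bounded below for [0 < a < 1]. For any
    other [a], [inf] is [0] when the set is empty or unbounded below; within
    [[0, 1]] this concerns only the null set [{0, 1}]. *)
Definition left_quantile (R : realType) (P : probability (measurableTypeR R) R)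
    (a : R) : R := inf [set t | a <= cdf_of P t].

Definition right_quantile (R : realType) (P : probability (measurableTypeR R) R)
    (a : R) : R := inf [set t | a < cdf_of P t].

Definition argmin (T : Type) (d : Order.disp_t) (V : porderType d)
    (C : set T) (f : T -> V) : set T :=
  [set x | C x /\ forall y, C y -> (f x <= f y)%O].

Definition poly_of_coefs (R : realType) (p : nat) (s : 'cV[R]_p.+1) : {poly R} :=
  \sum_(i < p.+1) s i 0 *: 'X^i.

Definition admissible (R : realType) (t0 t1 z0 z1 : R) (L : {poly R}) : Prop :=
  [/\ L.[t0] = z0, L.[t1] = z1 &
      forall x, x \in `[t0, t1] -> 0 <= (L^`()).[x]].

Definition feasible_poly (R : realType) (p : nat) (t0 t1 z0 z1 : R) :
    set {poly R} :=
  [set L : {poly R} | (size L <= p.+1)%N /\ admissible t0 t1 z0 z1 L].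

(** Extended-real valued, so that no integrability is presupposed. *)
Definition l2_cost (R : realType) (P : probability (measurableTypeR R) R)
    (t0 t1 : R) (L : {poly R}) : \bar R :=
  (\int[lebesgue_measure]_(x in `[t0, t1])
     ((left_quantile P x - L.[x]) ^+ 2)%:E)%E.

(** Rows and columns are numbered from [0], hence the exponent [i + j]. *)
Definition moment_mx (R : realType) (p : nat) (t0 t1 : R) : 'M[R]_p.+1 :=
  \matrix_(i, j) \int[lebesgue_measure]_(x in `[t0, t1]) (x ^+ (i + j)).

Definition moment_vec (R : realType) (P : probability (measurableTypeR R) R)
    (p : nat) (t0 t1 : R) : 'cV[R]_p.+1 :=
  \col_i \int[lebesgue_measure]_(x in `[t0, t1])
     (x ^+ i * right_quantile P x).

Definition feasible_coefs (R : realType) (p : nat) (t0 t1 z0 z1 : R) :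
    set 'cV[R]_p.+1 :=
  [set s | admissible t0 t1 z0 z1 (poly_of_coefs s)].

Definition qp_cost (R : realType) (n : nat) (M : 'M[R]_n) (r s : 'cV[R]_n) : R :=
  (s^T *m M *m s) 0 0 - 2 * (s^T *m r) 0 0.

Definition posdefmx (R : realType) (n : nat) (M : 'M[R]_n) : Prop :=
  forall v : 'cV[R]_n, v != 0 -> 0 < (v^T *m M *m v) 0 0.

(* Main.v *)
Require Import Defs.
From HB Require Import structures.
From mathcomp Require Import all_boot all_order all_algebra.
From mathcomp Require Import all_classical all_reals all_analysis.
From mathcomp Require Import measurable_realfun.
From mathcomp Require Import ring lra.

Set Implicit Arguments.
Unset Strict Implicit.
Unset Printing Implicit Defensive.

Import Order.TTheory GRing.Theory Num.Theory.
Import numFieldNormedType.Exports.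
Local Open Scope classical_set_scope.
Local Open Scope ring_scope.

(** The heart of the matter is that the [L^2] objective and the quadratic
    objective differ by a constant.  Let [q] be the left quantile function of
    [P] and [L] the polynomial with coefficient vector [s].  Expanding the
    square,
      int (q - L)^2 = int q^2 - 2 int q L + int L^2,
    where, by linearity of the integral, [int L^2] is the quadratic form of
    the moment matrix at [s] ([moment_mx_form]) and [int q L] is the scalar
    product of [s] with the vector of the [int x^i q(x) dx].

    Two facts on quantiles make this meaningful.  First, [int q^2] has to be
    finite.  The inverse transform principle gives it: [q(a) <= t] is
    equivalent to [a <= F(t)] ([left_quantile_le]), so [q] transports the
    uniform measure on [(0, 1)] to a measure with the same cdf as [P], hence to
    [P] itself, and [int_0^1 q^2] is the second moment of [P]
    ([integral_left_quantile]).  Second, the vector [r] is written with the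
    right quantile function.  The two quantile functions differ at [a] only if
    [F] takes the value [a] on a nondegenerate interval, thus at a rational;
    so they differ at countably many levels only
    ([countable_quantile_neq]) and have the same integrals
    ([moment_vec_left_quantile]).

    Coefficient vectors correspond bijectively to polynomials of degree at most
    [p], feasible ones to feasible ones, so the minimizers correspond as well
    ([argmin_comp]).  The moment matrix is positive definite because its form
    is the integral of the square of a polynomial, which can only vanish if the
    polynomial does, a nonzero one having finitely many roots.  The feasible
    set is closed and convex because it is cut out by equations and
    inequalities between constants and continuous linear forms in [s]. *)

(** * Measurability of monotone functions, and measures on the line *)

(** Monotonicity is asked on the interval only: outside [(0, 1)] the quantile
    functions take default values that break it. *)
Lemma nondecreasing_in_itv_measurable (R : realType) (i : interval R)
    (f : R -> R) :
  {in i &, {homo f : x y / x <= y}} -> measurable_fun [set` i] f.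
Proof.
move=> fnd mi; apply: (measurability (@RGenCInfty.G R)) => [||//].
  exact: RGenCInfty.measurableE.
move=> /= _ [_ [r ->] <-]; apply: is_interval_measurable => s t /=.
move=> [si rs] [ti rt] u sut.
have ui : [set` i] u := interval_is_interval si ti sut.
split; first exact: ui.
rewrite /= in_itv/= andbT; move: rs; rewrite in_itv/= andbT => /le_trans.
by apply; apply: fnd => //; case/andP: sut.
Qed.

(** Closed left rays are stable under intersection and generate the Borel sets,
    since [(x, y]] is a difference of two of them. *)
Lemma eq_measure_rays (R : realType)
    (m1 m2 : {measure set (measurableTypeR R) -> \bar R}) :
  (forall t, m1 `]-oo, t]%classic = m2 `]-oo, t]%classic) ->
  (forall t, m1 `]-oo, t]%classic < +oo)%E ->
  forall A, measurable A -> m1 A = m2 A.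
Proof.
move=> m12 m1oo.
pose rays : set (set R) := [set A | exists t, A = `]-oo, t]%classic].
apply: (@measure_unique _ R (measurableTypeR R) rays
  (fun n => `]-oo, n%:R]%classic)) => //.
- rewrite eqEsubset; split => A.
    apply: smallest_sub; first exact: smallest_sigma_algebra.
    move=> _ [[x y] _ <-] /=.
    have sR t : (<<s rays >> `]-oo, t]%classic).
      by apply: sub_sigma_algebra; exists t.
    rewrite (_ : `]x, y]%classic = `]-oo, y]%classic `\` `]-oo, x]%classic).
      by apply: (@measurableD _ (g_sigma_algebraType rays)); exact: sR.
    apply/seteqP; split => t /=; rewrite !in_itv/=.
      by move=> /andP[xt ty]; split => //; apply/negP; rewrite -ltNge.
    by move=> [-> /negP]; rewrite -ltNge => ->.
  apply: smallest_sub; first exact: sigma_algebra_measurable.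
  by move=> _ [t ->]; exact: measurable_itv.
- move=> _ _ [s ->] [t ->]; exists (Num.min s t); apply/seteqP; split => u /=.
    by rewrite !in_itv/= le_min => -[-> ->].
  by rewrite !in_itv/= le_min => /andP[].
- by move=> n; exists n%:R.
- apply/seteqP; split => // t _; exists (Num.truncn t).+1 => //=.
  by rewrite in_itv/= ltW// truncnS_gt.
- by move=> _ [t ->].
Qed.

Lemma integral_mrestr (d : measure_display) (T : measurableType d)
    (R : realType) (mu : {measure set T -> \bar R}) (D : set T)
    (mD : measurable D) (f : T -> \bar R) : measurable_fun setT f ->
  (forall x, 0 <= f x)%E ->
  (\int[mrestr mu mD]_x f x = \int[mu]_(x in D) f x)%E.
Proof.
move=> mf f0.
rewrite -(setUv D) ge0_integral_setU//=; last 3 first.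
- exact: measurableC.
- by rewrite setUv.
- exact/disj_setPCl.
rewrite (@null_set_integral _ _ _ (mrestr mu mD) (~` D))//; last 3 first.
- exact: measurableC.
- exact: measurable_funTS.
- by rewrite -[LHS]/(mu (~` D `&` D)) setICl measure0.
rewrite adde0; apply: eq_measure_integral => A mA AD.
by rewrite -[LHS]/(mu (A `&` D)) setIidl.
Qed.

(** * Distribution function and quantiles *)

Section quantiles.
Context (R : realType) (P : probability (measurableTypeR R) R).

Let idTR : measurableTypeR R -> R := idfun.

#[local] HB.instance Definition _ :=
  @isMeasurableFun.Build _ _ _ _ idTR (@measurable_id _ _ setT).

Let cdf_ofE : cdf_of P = fine \o cdf (idTR : {RV P >-> R}).
Proof. by []. Qed.

Lemma cdf_of_nondecreasing : {homo cdf_of P : s t / s <= t}.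
Proof.
move=> s t st; rewrite cdf_ofE /= fine_le ?fin_num_measure//.
exact: cdf_nondecreasing.
Qed.

Lemma cdf_of_right_continuous : right_continuous (cdf_of P).
Proof.
move=> a; rewrite cdf_ofE; apply: fine_cvg => /=.
by rewrite fineK ?fin_num_measure//; exact: cdf_right_continuous.
Qed.

Lemma cdf_of_cvgNy : cdf_of P t @[t --> -oo] --> (0 : R).
Proof. by rewrite cdf_ofE; exact/fine_cvg/cvg_cdfNy0. Qed.

Lemma cdf_of_cvgy : cdf_of P t @[t --> +oo] --> (1 : R).
Proof. by rewrite cdf_ofE; exact/fine_cvg/cvg_cdfy1. Qed.

Lemma cdf_of_ge0 t : 0 <= cdf_of P t.
Proof. exact: fine_ge0. Qed.

Lemma cdf_of_le1 t : cdf_of P t <= 1.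
Proof. by rewrite cdf_ofE -lee_fin /= fineK ?fin_num_measure// cdf_le1. Qed.

Lemma cdf_of_lt (a : R) : 0 < a -> exists t, cdf_of P t < a.
Proof.
move=> a0; have /cvgr_lt/(_ _ a0)[M [_ Ma]] := cdf_of_cvgNy.
by exists (M - 1); apply: Ma; rewrite /= ltrBlDr ltrDl.
Qed.

Lemma cdf_of_gt (a : R) : a < 1 -> exists t, a < cdf_of P t.
Proof.
move=> a1; have /cvgr_gt/(_ _ a1)[M [_ Ma]] := cdf_of_cvgy.
by exists (M + 1); apply: Ma; rewrite /= ltrDl.
Qed.

Lemma left_quantile_has_inf (a : R) : 0 < a < 1 ->
  has_inf [set t | a <= cdf_of P t].
Proof.
move=> /andP[a0 a1]; split.
  by have [t /ltW ?] := cdf_of_gt a1; exists t.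
have [t ta] := cdf_of_lt a0; exists t => u /= au.
rewrite leNgt; apply/negP => /ltW /cdf_of_nondecreasing ut.
by have := le_lt_trans (le_trans au ut) ta; rewrite ltxx.
Qed.

Lemma right_quantile_has_inf (a : R) : 0 < a < 1 ->
  has_inf [set t | a < cdf_of P t].
Proof.
move=> a01; split; first by case/andP: a01 => _ /cdf_of_gt.
have [_ [m lbm]] := left_quantile_has_inf a01.
by exists m => t /= /ltW; exact: lbm.
Qed.

(** The Galois connection between [F] and its left inverse; right-continuity of
    [F] is what makes the infimum defining the quantile attained. *)
Lemma left_quantile_le (a t : R) : 0 < a < 1 ->
  (left_quantile P a <= t) = (a <= cdf_of P t).
Proof.
move=> a01; have [ne lb] := left_quantile_has_inf a01.
apply/idP/idP => [qt|at_]; last exact: ge_inf.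
rewrite leNgt; apply/negP => ta.
have /cvgr_lt/(_ _ ta) := @cdf_of_right_continuous t.
case => e /= e0 ea.
have ta' : cdf_of P (t + e / 2) < a.
  apply: ea => /=; last by rewrite ltrDl divr_gt0.
  rewrite opprD addrA subrr sub0r normrN gtr0_norm ?divr_gt0//.
  by rewrite ltr_pdivrMr// ltr_pMr// ltr1n.
have : t + e / 2 <= left_quantile P a.
  apply: lb_le_inf => // u /= au; rewrite leNgt; apply/negP => /ltW.
  move=> /cdf_of_nondecreasing/(le_trans au)/le_lt_trans/(_ ta').
  by rewrite ltxx.
by rewrite leNgt => /negP; apply; rewrite (le_lt_trans qt)// ltrDl divr_gt0.
Qed.

Lemma left_quantile_le_right (a : R) : 0 < a < 1 ->
  left_quantile P a <= right_quantile P a.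
Proof.
move=> a01; have [ne _] := right_quantile_has_inf a01.
by apply: lb_le_inf => // t /= /ltW; rewrite left_quantile_le.
Qed.

Lemma left_quantile_nondecreasing :
  {in `]0, 1[ &, {homo left_quantile P : a b / a <= b}}.
Proof.
move=> a b; rewrite !in_itv/= => a01 b01 ab.
by rewrite left_quantile_le// (le_trans ab)// -left_quantile_le.
Qed.

Lemma right_quantile_nondecreasing :
  {in `]0, 1[ &, {homo right_quantile P : a b / a <= b}}.
Proof.
move=> a b; rewrite !in_itv/= => a01 b01 ab.
have [ne _] := right_quantile_has_inf b01.
apply: lb_le_inf => // t /= bt; apply: ge_inf => /=.
  by have [] := right_quantile_has_inf a01.
exact: le_lt_trans bt.
Qed.

(** If [q(a) < t] and [t] is less than the right quantile at [a], then
    [F(t) = a]; taking [t] rational exhibits [a] in the image of a countable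
    set. *)
Lemma countable_quantile_neq :
  countable [set a | 0 < a < 1 /\ left_quantile P a != right_quantile P a].
Proof.
apply: (@sub_countable _ _ _ (cdf_of P @` range (@ratr R))); last first.
  do 2 apply: (card_le_trans (card_image_le _ _)); exact: countableP.
apply: subset_card_le => a /= [a01 neq].
have : left_quantile P a < right_quantile P a.
  by rewrite lt_neqAle neq left_quantile_le_right.
move=> /rat_in_itvoo[q]; rewrite in_itv/= => /andP[lq qr].
exists (ratr q); first by exists q.
have aq : a <= cdf_of P (ratr q) by rewrite -left_quantile_le// ltW.
apply/eqP; rewrite eq_le aq andbT leNgt; apply/negP => {}aq.
move: qr; rewrite ltNge => /negP; apply.
by apply: ge_inf => //; have [] := right_quantile_has_inf a01.
Qed.

Lemma measurable_left_quantile : measurable_fun `[0 : R, 1] (left_quantile P).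
Proof.
apply: (@measurable_fun_itv_cc _ _ _ false true).
apply: nondecreasing_in_itv_measurable; exact: left_quantile_nondecreasing.
Qed.

Lemma measurable_right_quantile : measurable_fun `[0 : R, 1] (right_quantile P).
Proof.
apply: (@measurable_fun_itv_cc _ _ _ false true).
apply: nondecreasing_in_itv_measurable; exact: right_quantile_nondecreasing.
Qed.

End quantiles.

Section quantile_pushforward.
Context (R : realType) (P : probability (measurableTypeR R) R).

(* Extended by 0 outside (0, 1), where left_quantile need not be monotone, in
   order to be a measurable map on the whole line. *)
Let Q : measurableTypeR R -> measurableTypeR R := left_quantile P \_ `]0, 1[.

Let mQ : measurable_fun setT Q.
Proof.
apply/(measurable_restrictT _ _).1 => //.
apply: nondecreasing_in_itv_measurable; exact: left_quantile_nondecreasing.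
Qed.

Let unif := mrestr (@lebesgue_measure R) (measurable_itv `]0, 1[).

Let unif_left_quantile_le t : unif (Q @^-1` `]-oo, t]) = P `]-oo, t]%classic.
Proof.
have PE : P `]-oo, t]%classic = (cdf_of P t)%:E.
  by rewrite fineK// fin_num_measure.
rewrite -[LHS]/(lebesgue_measure
  (Q @^-1` `]-oo, t]%classic `&` `]0, 1[%classic)).
have -> : Q @^-1` `]-oo, t]%classic `&` `]0, 1[%classic =
    `]0, 1[%classic `&` [set a | a <= cdf_of P t].
  rewrite setIC.
  have QF a : a \in `]0, 1[ -> (Q a \in `]-oo, t]) = (a <= cdf_of P t).
    by move=> a01; rewrite in_itv/= /Q patchE mem_set// left_quantile_le.
  by apply/seteqP; split => a /= [a01]; move: (a01) => /QF->.
(* If F t = 1, the intersection is ]0, 1[ and not ]0, F t]. *)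
have [F1|F1] := eqVneq (cdf_of P t) 1.
  rewrite setIidl; last by move=> a /=; rewrite F1 in_itv/= => /andP[_ /ltW].
  by rewrite lebesgue_measure_itv/= lte_fin ltr01 oppr0 adde0 PE F1.
have -> : `]0, 1[%classic `&` [set a | a <= cdf_of P t] =
    `]0, cdf_of P t]%classic.
  apply/seteqP; split => a /=; rewrite !in_itv/=.
    by move=> [/andP[-> _] ->].
  move=> /andP[-> aF]; split => //=; rewrite (le_lt_trans aF)// lt_neqAle F1.
  exact: cdf_of_le1.
rewrite lebesgue_measure_itv/= lte_fin PE oppr0 adde0; case: ltP => // F0.
by congr _%:E; apply/eqP; rewrite eq_le F0 cdf_of_ge0.
Qed.

(** Inverse transform sampling: [left_quantile P] sends the uniform law on
    [(0, 1)] to [P]. *)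
Lemma integral_left_quantile (f : R -> R) : measurable_fun setT f ->
  (forall x, 0 <= f x) ->
  (\int[lebesgue_measure]_(x in `]0%R, 1%R[) (f (left_quantile P x))%:E =
   \int[P]_x (f x)%:E)%E.
Proof.
move=> mf f0.
transitivity (\int[lebesgue_measure]_(x in `]0%R, 1%R[) (f (Q x))%:E)%E.
  by apply: eq_integral => x x01; rewrite /Q patchE x01.
rewrite -(integral_mrestr lebesgue_measure (measurable_itv `]0, 1[));
  last 2 first.
- by apply/measurable_EFinP; exact: measurableT_comp.
- by move=> x; rewrite lee_fin.
transitivity (\int[pushforward unif Q]_x (f x)%:E)%E.
  rewrite ge0_integral_pushforward//; first exact/measurable_EFinP.
  by move=> x _; rewrite lee_fin.
apply: eq_measure_integral => A mA _.
apply: eq_measure_rays => [|t|//]; first exact: unif_left_quantile_le.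
apply: (@le_lt_trans _ _ (P `]-oo, t]%classic)).
  by rewrite -unif_left_quantile_le.
by rewrite (le_lt_trans (probability_le1 _ _))// ltry.
Qed.

End quantile_pushforward.

(** * Integrals of polynomials *)

Section poly_integral.
Context (R : realType).
Local Notation mu := (@lebesgue_measure R).
Implicit Types (p : {poly R}) (a b : R).

Lemma Rintegral_deriv_poly p a b : a < b ->
  \int[mu]_(x in `[a, b]) p^`().[x] = p.[b] - p.[a].
Proof.
move=> ab; rewrite /Rintegral (@continuous_FTC2 _ _ (horner p))//.
- exact/continuous_subspaceT/continuous_horner.
- split=> [x _||].
  + exact: derivable_horner.
  + exact/cvg_at_right_filter/continuous_horner.
  + exact/cvg_at_left_filter/continuous_horner.
- by move=> x _; rewrite derivE.
Qed.

Lemma Rintegral_exprn n a b : a < b ->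
  \int[mu]_(x in `[a, b]) (x ^+ n) = (b ^+ n.+1 - a ^+ n.+1) / n.+1%:R.
Proof.
move=> ab; pose p : {poly R} := n.+1%:R^-1 *: 'X^(n.+1).
transitivity (\int[mu]_(x in `[a, b]) p^`().[x]).
  apply: eq_Rintegral => x _.
  rewrite derivZ derivXn !hornerE hornerMn hornerXn mulrnAr -mulrnAl.
  by rewrite -mulr_natr mulVf ?mul1r ?pnatr_eq0.
by rewrite Rintegral_deriv_poly// !hornerE -mulrBr mulrC.
Qed.

Lemma integrable_polyfun p (f : R -> R) a b : f =1 horner p ->
  mu.-integrable `[a, b] (EFin \o f).
Proof.
move=> /funext ->; apply: continuous_compact_integrable.
  exact: segment_compact.
exact/continuous_subspaceT/continuous_horner.
Qed.

Lemma countable_lebesgue_negligible (A : set R) :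
  countable A -> mu.-negligible A.
Proof.
move=> cA; exists A; split => //; first exact: countable_measurable.
exact: countable_lebesgue_measure0.
Qed.

Lemma finite_set_root p : p != 0 -> finite_set [set x | root p x].
Proof.
move=> p0; apply: contrapT => /(infinite_set_fset (size p))[B Bp].
apply/negP; rewrite -ltnNge; apply: max_poly_roots => //.
  by apply/allP => x; exact: Bp.
exact: finmap.fset_uniq.
Qed.

(** A vanishing integral would make the square vanish almost everywhere; the
    whole interval would then be the union of a negligible set and of the
    finite set of roots. *)
Lemma Rintegral_sqr_horner_gt0 p a b : a < b -> p != 0 ->
  0 < \int[mu]_(x in `[a, b]) (p.[x] ^+ 2).
Proof.
move=> ab p0.
have ip2 : mu.-integrable `[a, b] (EFin \o (fun x => p.[x] ^+ 2)).
  by apply: (@integrable_polyfun (p ^+ 2)) => x; rewrite horner_exp.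
rewrite lt_neqAle Rintegral_ge0 ?andbT; last by move=> x _; exact: sqr_ge0.
apply/negP => /eqP I0.
suff : lebesgue_measure `[a, b]%classic = 0%E :> \bar R.
  rewrite lebesgue_measure_itv/= lte_fin ab => /eqP.
  by rewrite -EFinB eqe subr_eq0 gt_eqF.
apply: measure_negligible; first exact: measurable_itv.
have [N [mN N0 Nsub]] : ae_eq mu `[a, b]%classic
    (EFin \o (fun x => p.[x] ^+ 2)) (cst 0%E).
  apply/ae_eq_integral_abs => //; first exact: measurable_int ip2.
  rewrite -[RHS]/(0%:E) I0 fineK; last exact: integrable_fin_num ip2.
  by apply: eq_integral => x _ /=; rewrite ger0_norm// sqr_ge0.
apply: (@negligibleS _ _ _ mu (N `|` [set x | root p x])).
  move=> x xab; have [rx|rx] := boolP (root p x); [by right|left].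
  by apply: Nsub => /= /(_ xab) [] /eqP; rewrite expf_eq0 /= -rootE (negbTE rx).
apply: (@negligibleU _ (measurableTypeR R)).
  by exists N; split.
exact/countable_lebesgue_negligible/finite_set_countable/finite_set_root.
Qed.

End poly_integral.

(** * Coefficient vectors and the moment matrix *)

Section coefficients.
Context (R : realType).
Local Notation mu := (@lebesgue_measure R).
Implicit Types a b : R.

(** Linearity for finite combinations, together with integrability, which the
    additivity of the real-valued integral requires at each step. *)
Lemma Rintegral_linear (d : measure_display) (T : measurableType d)
    (m : {measure set T -> \bar R}) (D : set T) (mD : measurable D)
    (I : Type) (r : seq I) (c : I -> R) (f : I -> T -> R) :
  (forall i, m.-integrable D (EFin \o f i)) ->
  m.-integrable D (EFin \o (fun x => \sum_(i <- r) c i * f i x)) /\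
  \int[m]_(x in D) (\sum_(i <- r) c i * f i x) =
    \sum_(i <- r) c i * \int[m]_(x in D) f i x.
Proof.
move=> fi; have cfi i : m.-integrable D (EFin \o (fun x => c i * f i x)).
  by have := integrableZl mD (c i) (fi i).
elim: r => [|i r [ihi ihI]].
  split; last first.
    under eq_Rintegral do rewrite big_nil.
    by rewrite Rintegral_cst ?mul0r ?big_nil.
  apply: (eq_integrable mD _ _ _ (integrable0 m D)) => // x _ /=.
  by rewrite big_nil.
split.
  apply: (eq_integrable mD _ _ _ (integrableD mD (cfi i) ihi)) => // x _ /=.
  by rewrite big_cons.
under eq_Rintegral do rewrite big_cons.
by rewrite RintegralD// RintegralZl// ihI big_cons.
Qed.

Lemma horner_poly_of_coefs p (s : 'cV[R]_p.+1) x :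
  (poly_of_coefs s).[x] = \sum_i s i 0 * x ^+ i.
Proof.
by rewrite horner_sum; apply: eq_bigr => i _; rewrite hornerZ hornerXn.
Qed.

Lemma moment_mxE p a b (i j : 'I_p.+1) : a < b ->
  moment_mx p a b i j = (b ^+ (i + j).+1 - a ^+ (i + j).+1) / (i + j).+1%:R.
Proof. by move=> ab; rewrite mxE Rintegral_exprn. Qed.

(** The form is evaluated by linearity in each factor of [L(x) * L(x)] in turn:
    the coefficient of [s_i s_j] is the integral of [x ^ (i + j)]. *)
Lemma moment_mx_form p a b (s : 'cV[R]_p.+1) :
  (s^T *m moment_mx p a b *m s) 0 0 =
  \int[mu]_(x in `[a, b]) ((poly_of_coefs s).[x] ^+ 2).
Proof.
have iX (n : nat) q :
    mu.-integrable `[a, b] (EFin \o (fun x => x ^+ n * q.[x])).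
  by apply: (@integrable_polyfun _ ('X^n * q)) => x; rewrite hornerM hornerXn.
have iXX (i j : nat) :
    mu.-integrable `[a, b] (EFin \o (fun x : R => x ^+ (i + j))).
  by apply: (@integrable_polyfun _ 'X^(i + j)) => x; rewrite hornerXn.
transitivity (\sum_i s i 0 *
    \int[mu]_(x in `[a, b]) (x ^+ i * (poly_of_coefs s).[x])); last first.
  rewrite -(Rintegral_linear (m := mu) (measurable_itv `[a, b]) _
    (fun i => s i 0) (fun i : 'I_p.+1 => iX i _)).2.
  apply: eq_Rintegral => x _.
  under eq_bigr do rewrite mulrA.
  by rewrite -mulr_suml -horner_poly_of_coefs expr2.
rewrite -mulmxA mxE; apply: eq_bigr => i _; rewrite !mxE; congr (_ * _).
under [RHS]eq_Rintegral.
  move=> x _; rewrite horner_poly_of_coefs mulr_sumr.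
  under eq_bigr do rewrite mulrCA -exprD.
  over.
rewrite (Rintegral_linear (m := mu) (measurable_itv `[a, b]) _
  (fun j => s j 0) (fun j : 'I_p.+1 => iXX i j)).2.
by apply: eq_bigr => j _; rewrite mxE mulrC.
Qed.

Lemma moment_mx_sym p a b : moment_mx p a b \is symmetricmx.
Proof.
apply/is_hermitianmxP; rewrite expr0 scale1r; apply/matrixP => i j.
by rewrite !mxE addnC.
Qed.

Lemma coef_poly_of_coefs p (s : 'cV[R]_p.+1) (i : 'I_p.+1) :
  (poly_of_coefs s)`_i = s i 0.
Proof.
rewrite coef_sum (bigD1 i)//= coefZ coefXn eqxx mulr1 big1 ?addr0// => j ji.
by rewrite coefZ coefXn (inj_eq val_inj) eq_sym (negbTE ji) mulr0.
Qed.

Lemma poly_of_coefs_inj p : injective (@poly_of_coefs R p).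
Proof.
move=> s t st; apply/matrixP => i j; rewrite ord1.
by rewrite -!coef_poly_of_coefs st.
Qed.

Lemma size_poly_of_coefs p (s : 'cV[R]_p.+1) :
  (size (poly_of_coefs s) <= p.+1)%N.
Proof.
apply: (leq_trans (size_sum _ _ _)); apply/bigmax_leqP => i _.
by rewrite (leq_trans (size_scale_leq _ _))// size_polyXn.
Qed.

Lemma poly_of_coefs_surj p (L : {poly R}) : (size L <= p.+1)%N ->
  L = poly_of_coefs (\col_(i < p.+1) L`_i).
Proof.
move=> sL; apply/polyP => i; have [ip|ip] := ltnP i p.+1.
  by rewrite (coef_poly_of_coefs _ (Ordinal ip)) mxE.
by rewrite !nth_default// (leq_trans _ ip)// size_poly_of_coefs.
Qed.

Lemma moment_mx_posdef p a b : a < b -> posdefmx (moment_mx p a b).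
Proof.
move=> ab v v0; rewrite moment_mx_form Rintegral_sqr_horner_gt0//.
apply: contra_neq v0 => Lv0; apply: poly_of_coefs_inj.
by rewrite Lv0 /poly_of_coefs big1// => i _; rewrite mxE scale0r.
Qed.

End coefficients.

(** * Expansion of the least squares objective *)

Section objective.
Context (R : realType) (P : probability (measurableTypeR R) R)
  (P2 : finite_second_moment P) (t0 t1 : R).
Hypotheses (t0_ge0 : 0 <= t0) (t1_le1 : t1 <= 1).
Local Notation mu := (@lebesgue_measure R).
Local Notation q := (left_quantile P).

Let sub01 : `[t0, t1] `<=` `[0, 1].
Proof. by apply: subset_itv; rewrite bnd_simp. Qed.

Let mD : measurable (`[t0, t1]%classic : set (measurableTypeR R)).
Proof. exact: measurable_itv. Qed.

Let mq : measurable_fun `[t0, t1] q.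
Proof. exact: measurable_funS (measurable_left_quantile P). Qed.

Lemma integrable_sqr_left_quantile :
  mu.-integrable `[t0, t1] (EFin \o (fun x => q x ^+ 2)).
Proof.
have mq2 : measurable_fun (`[0, 1] : set R) (fun x => (q x ^+ 2)%:E).
  apply/measurable_EFinP; apply: measurable_funX.
  exact: measurable_left_quantile.
apply: (@integrableS _ (measurableTypeR R) _ mu `[0, 1] `[t0, t1]) => //.
apply/integrableP; split; first exact: mq2.
under eq_integral do rewrite /= ger0_norm ?sqr_ge0//.
rewrite integral_itv_bndoo; last first.
  by apply: measurable_funS mq2 => //; exact: subset_itv_oo_cc.
rewrite (@integral_left_quantile _ P (fun x => x ^+ 2))//.
by move=> x; exact: sqr_ge0.
Qed.

(** On [[0, 1]], [|x ^ n q(x)| <= |q(x)| <= 1 + q(x) ^ 2]. *)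
Lemma integrable_exprn_left_quantile n :
  mu.-integrable `[t0, t1] (EFin \o (fun x => x ^+ n * q x)).
Proof.
have i1 : mu.-integrable `[t0, t1] (EFin \o cst (1:R)).
  by apply: (@integrable_polyfun _ 1) => x; rewrite hornerC.
apply: (@le_integrable _ (measurableTypeR R) _ mu `[t0, t1] mD
  _ (EFin \o (fun x => 1 + q x ^+ 2))).
- apply/measurable_EFinP; apply: measurable_funM; last exact: mq.
  exact: exprn_measurable.
- move=> x /sub01; rewrite /= in_itv/= => /andP[x0 x1].
  rewrite lee_fin normrM normrX ger0_norm// [leRHS]ger0_norm; last first.
    by rewrite addr_ge0// sqr_ge0.
  rewrite (@le_trans _ _ `|q x|)//.
    by rewrite ler_piMl// exprn_ile1.
  rewrite -[q x ^+ 2]real_normK ?num_real//.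
  by have := sqr_ge0 (`|q x| - 1); have := normr_ge0 (q x); nra.
- exact: (integrableD mD i1 integrable_sqr_left_quantile).
Qed.

Lemma moment_vec_left_quantile p (i : 'I_p.+1) :
  moment_vec P p t0 t1 i 0 = \int[mu]_(x in `[t0, t1]) (x ^+ i * q x).
Proof.
rewrite mxE; congr fine; apply: ae_eq_integral.
- exact: measurable_itv.
- apply/measurable_EFinP; apply: measurable_funM; first exact: exprn_measurable.
  exact: measurable_funS (measurable_right_quantile P).
- apply/measurable_EFinP; apply: measurable_funM; first exact: exprn_measurable.
  exact: mq.
have nN : mu.-negligible
    ([set a | 0 < a < 1 /\ q a != right_quantile P a] `|` [set 0; 1]).
  apply: (@negligibleU _ (measurableTypeR R));
    apply: countable_lebesgue_negligible; first exact: countable_quantile_neq.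
  exact: finite_set_countable.
apply: negligibleS nN.
move=> x /= /not_implyP[/sub01]; rewrite /= in_itv/= => /andP[x0 x1] neq.
have [->|x0'] := eqVneq x 0; first by right; left.
have [->|x1'] := eqVneq x 1; first by right; right.
left; rewrite !lt_neqAle x0 x1 x1' eq_sym x0'; split => //.
by apply: contra_not_neq neq => ->.
Qed.

(** The first summand does not depend on [s], so both objectives order the
    coefficient vectors in the same way. *)
Lemma l2_cost_poly_of_coefs p (s : 'cV[R]_p.+1) :
  l2_cost P t0 t1 (poly_of_coefs s) =
  (\int[mu]_(x in `[t0, t1]) (q x ^+ 2) +
   qp_cost (moment_mx p t0 t1) (moment_vec P p t0 t1) s)%:E.
Proof.
have iq2 := integrable_sqr_left_quantile.
have [iLq LqE] := Rintegral_linear (m := mu) mD (index_enum 'I_p.+1)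
  (fun i => s i 0) (fun i : 'I_p.+1 => integrable_exprn_left_quantile i).
have iL2 : mu.-integrable `[t0, t1]
    (EFin \o (fun x => (poly_of_coefs s).[x] ^+ 2)).
  apply: (@integrable_polyfun _ (poly_of_coefs s ^+ 2)) => x.
  by rewrite horner_exp.
have iLq2 := integrableZl mD 2 iLq.
have iB := integrableB mD iL2 iLq2.
have iall := integrableD mD iq2 iB.
have costE x : (q x - (poly_of_coefs s).[x]) ^+ 2 =
    q x ^+ 2 + ((poly_of_coefs s).[x] ^+ 2 -
      2 * (\sum_(i < p.+1) s i 0 * (x ^+ i * q x))).
  under eq_bigr do rewrite mulrA.
  by rewrite -mulr_suml -horner_poly_of_coefs; ring.
rewrite /l2_cost; under eq_integral do rewrite costE.
rewrite -[LHS]fineK; last exact: (integrable_fin_num mD iall).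
rewrite -[fine _]/(Rintegral _ _ _) RintegralD// RintegralB// RintegralZl// LqE.
rewrite -moment_mx_form /qp_cost; congr (_ + (_ - 2 * _))%:E.
by rewrite mxE; apply: eq_bigr => i _; rewrite moment_vec_left_quantile mxE.
Qed.

End objective.

(** * The feasible set *)

Section feasible.
Context (R : realType) (p : nat).

(** Stated for any linear form [g], to cover evaluation of a polynomial and of
    its derivative at once. *)
Lemma continuous_linear_form (g : {linear {poly R} -> R}) :
  continuous (fun s : 'cV[R]_p.+1 => g (poly_of_coefs s)).
Proof.
have -> : (fun s : 'cV[R]_p.+1 => g (poly_of_coefs s)) =
   (fun s => \sum_i s i 0 * g 'X^i).
  apply/funext => s; rewrite linear_sum.
  by apply: eq_bigr => i _; rewrite linearZ.
apply: continuous_big => [|i _ s]; first exact: add_continuous.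
apply: (@continuousM R _ (fun s : 'cV[R]_p.+1 => s i 0) (fun=> g 'X^i)).
  exact: (@coord_continuous R _ _ i 0).
exact: cst_continuous.
Qed.

Lemma poly_of_coefsZD (k l : R) (s t : 'cV[R]_p.+1) :
  poly_of_coefs (k *: s + l *: t) = k *: poly_of_coefs s + l *: poly_of_coefs t.
Proof.
rewrite /poly_of_coefs !scaler_sumr -big_split /=; apply: eq_bigr => i _.
by rewrite !mxE scalerDl !scalerA.
Qed.

Lemma feasible_coefs_closed t0 t1 z0 z1 :
  closed (@feasible_coefs R p t0 t1 z0 z1).
Proof.
have cl (g : {linear {poly R} -> R}) (A : set R) : closed A ->
    closed [set s : 'cV[R]_p.+1 | A (g (poly_of_coefs s))].
  by move=> cA; apply: closed_comp cA => s _; exact: continuous_linear_form.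
have -> : @feasible_coefs R p t0 t1 z0 z1 =
    [set s | [set z0] (horner_eval t0 (poly_of_coefs s))] `&`
    [set s | [set z1] (horner_eval t1 (poly_of_coefs s))] `&`
    \bigcap_(x in `[t0, t1]) [set s | [set y | 0 <= y]
       ((horner_eval x \o deriv) (poly_of_coefs s))].
  by apply/seteqP; split => [s [s0 s1 sd]|s [[s0 s1] sd]]; split.
apply: closedI; [apply: closedI|apply: closed_bigI => x _]; apply: cl.
- exact: closed_eq.
- exact: closed_eq.
- exact: closed_ge.
Qed.

Lemma feasible_coefs_convex t0 t1 z0 z1 :
  convex_set (@feasible_coefs R p t0 t1 z0 z1).
Proof.
move=> s t k; rewrite !inE => -[s0 s1 sd] [u0 u1 td].
change (admissible t0 t1 z0 z1
  (poly_of_coefs (k%:num *: (s : 'cV[R]_p.+1) + (1 - k%:num) *: t))).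
rewrite poly_of_coefsZD; split.
- by rewrite hornerD !hornerZ s0 u0 -mulrDl addrC subrK mul1r.
- by rewrite hornerD !hornerZ s1 u1 -mulrDl addrC subrK mul1r.
- move=> x x01; rewrite derivD !derivZ hornerD !hornerZ.
  by rewrite addr_ge0// mulr_ge0 ?sd ?td// subr_ge0.
Qed.

End feasible.

(** * Correspondence of the minimizers *)

(** Minimizers of a reparametrized problem: the objectives may take values in
    different orders, since only comparisons matter. *)
Lemma argmin_comp (S T : Type) (d e : Order.disp_t) (V : porderType d)
    (W : porderType e) (h : S -> T) (C : set S) (f : T -> V) (g : S -> W) :
  (forall s s', (f (h s) <= f (h s'))%O = (g s <= g s')%O) ->
  argmin (h @` C) f = h @` argmin C g.
Proof.
move=> fg; apply/seteqP; split => [_ [[s Cs <-] smin]|_ [s [Cs smin] <-]].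
  exists s => //; split => // s' Cs'; rewrite -fg; apply: smin.
  by exists s'.
split; first by exists s.
by move=> _ [s' Cs' <-]; rewrite fg; exact: smin.
Qed.

Lemma feasible_poly_image (R : realType) (p : nat) (t0 t1 z0 z1 : R) :
  feasible_poly p t0 t1 z0 z1 =
  @poly_of_coefs R p @` feasible_coefs t0 t1 z0 z1.
Proof.
apply/seteqP; split => [L [sL aL]|_ [s Ks <-]].
  exists (\col_(i < p.+1) L`_i); last by rewrite -poly_of_coefs_surj.
  by rewrite /feasible_coefs /= -poly_of_coefs_surj.
by split; [exact: size_poly_of_coefs|].
Qed.

Theorem theorem1 (R : realType) (P : probability (measurableTypeR R) R)
    (P2 : finite_second_moment P)
    (t0 t1 : R) (t0_ge0 : 0 <= t0) (t01 : t0 < t1) (t1_le1 : t1 <= 1)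
    (z0 z1 : R) (p : nat) (p_ge1 : (1 <= p)%N) :
  let M := moment_mx p t0 t1 in
  let r := moment_vec P p t0 t1 in
  let K := @feasible_coefs R p t0 t1 z0 z1 in
  let solA := argmin (feasible_poly p t0 t1 z0 z1) (l2_cost P t0 t1) in
  let solQP := argmin K (qp_cost M r) in
  [/\ forall i j : 'I_p.+1,
        M i j = (t1 ^+ (i + j).+1 - t0 ^+ (i + j).+1) / (i + j).+1%:R,
      M \is symmetricmx /\ posdefmx M,
      closed K /\ convex_set K
    & forall s : 'cV[R]_p.+1,
        (solA (poly_of_coefs s) <-> solQP s) /\
        (solA = [set poly_of_coefs s] <-> solQP = [set s])].
Proof.
move=> M r K solA solQP; split.
- by move=> i j; exact: moment_mxE.
- by split; [exact: moment_mx_sym|exact: moment_mx_posdef].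
- by split; [exact: feasible_coefs_closed|exact: feasible_coefs_convex].
have solAE : solA = @poly_of_coefs R p @` solQP.
  rewrite /solA feasible_poly_image; apply: argmin_comp => s s'.
  by rewrite !l2_cost_poly_of_coefs// lee_fin lerD2l.
move=> s; rewrite solAE; split; split.
- by move=> [s' solQPs' /poly_of_coefs_inj <-].
- by move=> solQPs; exists s.
- rewrite -image_set1 => e; apply/seteqP; split => s' /= s's.
    have : (@poly_of_coefs R p @` solQP) (poly_of_coefs s') by exists s'.
    by rewrite e => -[_ -> /poly_of_coefs_inj ->].
  have : (@poly_of_coefs R p @` [set s]) (poly_of_coefs s) by exists s.
  by rewrite -e s's => -[u qu /poly_of_coefs_inj <-].
- by move=> ->; rewrite image_set1.
Qed.
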